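(* Let $m,n$ be integers with $m,n\ge 4$ and $3\mid mn$. Then the rectangle $R(m,n)$ admits a faultfree tromino tiling.
   Context: $R(m,n)$ denotes the rectangle with $m$ rows and $n$ columns of unit squares. A tromino is an L-shaped tromino, i.e. a $2\times 2$ block of unit squares with one unit square removed, in any of its four orientations. A tromino tiling of $R(m,n)$ is a partition of its unit squares into trominoes. A fault line of a tiling is a horizontal or vertical line that cuts the rectangle into two (nonempty) pieces and does not pass through any of the tiles. A tiling is faultfree if it has no fault line. *)

(* Defs.v *)
From mathcomp Require Import all_boot.

Set Implicit Arguments.
Unset Strict Implicit.
Unset Printing Implicit Defensive.

(* The unit squares of R(m, n): (i, j) is the square in row i and column j,
   with rows and columns numbered from 0. *)
Definition square (m n : nat) : finType := ('I_m * 'I_n)%type.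

(* The 2 x 2 block with top left square (i, j); it is truncated by the border
   unless i.+1 < m and j.+1 < n. *)
Definition block (m n i j : nat) : {set square m n} :=
  [set c : square m n | (i <= c.1 <= i.+1) && (j <= c.2 <= j.+1)].

Definition tromino (m n : nat) (T : {set square m n}) : Prop :=
  exists i j : nat, [/\ i.+1 < m, j.+1 < n &
    exists2 c, c \in block m n i j & T = block m n i j :\ c].

Definition tromino_tiling (m n : nat) (P : {set {set square m n}}) : Prop :=
  partition P [set: square m n] /\ (forall T, T \in P -> tromino T).

(* A line which is not a grid line passes through the interior of unit squares,
   hence of tiles, so only grid lines can be fault lines. The horizontal line k
   separates rows 0, ..., k.-1 from rows k, ..., m.-1, and a tile is not crossed
   by it when all its squares lie on the same side. *)
Definition horizontal_fault (m n : nat) (P : {set {set square m n}}) (k : nat)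
    : Prop :=
  0 < k < m /\
  forall T, T \in P ->
    (forall c, c \in T -> c.1 < k) \/ (forall c, c \in T -> k <= c.1).

Definition vertical_fault (m n : nat) (P : {set {set square m n}}) (k : nat)
    : Prop :=
  0 < k < n /\
  forall T, T \in P ->
    (forall c, c \in T -> c.2 < k) \/ (forall c, c \in T -> k <= c.2).

Definition faultfree (m n : nat) (P : {set {set square m n}}) : Prop :=
  ~ (exists k, horizontal_fault P k) /\ ~ (exists k, vertical_fault P k).

(* Main.v *)
Require Import Defs.
From mathcomp Require Import all_boot.
From mathcomp Require Import zify.

Set Implicit Arguments.
Unset Strict Implicit.
Unset Printing Implicit Defensive.

(** Up to transposition [3] divides the number of columns, and the tilings grow
    from three explicit ones, of sizes 4 x 6, 5 x 6 and 5 x 9.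

    The growth step cuts a faultfree tiling along a jagged path that follows
    tile sides and borders, from one border of the rectangle to the opposite one,
    pulls the two parts away from each other and fills the gap with trominoes.
    Every old tile survives, up to translation, so the lines parallel to the
    translation stay crossed. For the other lines, the jaggedness is what matters:
    it lets the filling cross all the lines that the translation moves or creates,
    whereas a straight cut would become a fault line. All of this depends only on
    the tiles beyond the cut, a patch along the border. After the step the same
    patch lies along the new border, hence the step can be repeated.

    A patch at the right border adds three columns to tilings with four rows, or
    six columns to tilings with five rows; the latter step requires two initial
    tilings, 5 x 6 and 5 x 9. This gives every width divisible by 3 from 6 on,
    and it leaves intact a second patch at the bottom left
    corner. The latter, six columns wide, adds two rows; the other columns of these
    two rows form a rectangle whose width is a multiple of 3, which is filled with
    2 x 3 blocks: its lines are crossed elsewhere ([add_columns], [add_rows]).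

    These steps only exchange finite sets of tiles, so tilings are handled as
    lists of placed trominoes, for which the concrete steps are checked by
    computation; [crossed_tiling_faultfree] translates the outcome. *)

(** * Tilings as lists of placed trominoes *)

(** A tromino is encoded by the top left square of its 2 x 2 block and
    by the row and column, within that block, of the square that is removed. *)
Definition tile : Type := ((nat * nat) * (bool * bool))%type.

(* the compass direction is that of the removed square *)
Definition nw i j : tile := ((i, j), (false, false)).
Definition ne i j : tile := ((i, j), (false, true)).
Definition sw i j : tile := ((i, j), (true, false)).
Definition se i j : tile := ((i, j), (true, true)).

Definition corners : seq (bool * bool) :=
  [:: (false, false); (false, true); (true, false); (true, true)].

Definition cells (t : tile) : seq (nat * nat) :=
  [seq (t.1.1 + p.1, t.1.2 + p.2) | p : bool * bool <- corners & p != t.2].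

Definition region (L : seq tile) : seq (nat * nat) := flatten (map cells L).

Definition rows (L : seq tile) : seq nat := [seq t.1.1 | t <- L].
Definition cols (L : seq tile) : seq nat := [seq t.1.2 | t <- L].

Definition rect (m n : nat) : seq (nat * nat) :=
  [seq (i, j) | i <- iota 0 m, j <- iota 0 n].

(** A tromino meets both rows and both columns of its block, so it is crossed by
    the horizontal line [k] exactly when its block starts in row [k.-1], and
    likewise for columns. Hence the absence of fault lines amounts to the two
    inclusions below. *)
Definition crossed_tiling (m n : nat) (L : seq tile) : Prop :=
  [/\ perm_eq (region L) (rect m n),
      {subset iota 0 m.-1 <= rows L} & {subset iota 0 n.-1 <= cols L}].

Lemma mem_rect m n (c : nat * nat) : (c \in rect m n) = (c.1 < m) && (c.2 < n).
Proof.
case: c => x y; apply/allpairsP/idP => /=.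
  by case=> -[i j] /= []; rewrite !mem_iota => hi hj [-> ->]; lia.
by move=> h; exists (x, y); rewrite /= !mem_iota; split=> //; lia.
Qed.

Lemma rect_uniq m n : uniq (rect m n).
Proof. by apply: allpairs_uniq; rewrite ?iota_uniq // => -[a b] [c d] _ _ /= [-> ->]. Qed.

Lemma region_cat L1 L2 : region (L1 ++ L2) = region L1 ++ region L2.
Proof. by rewrite /region map_cat flatten_cat. Qed.

Lemma perm_region L1 L2 : perm_eq L1 L2 -> perm_eq (region L1) (region L2).
Proof. by move=> h; apply/perm_flatten/perm_map. Qed.

Lemma mem_region L c : reflect (exists2 t : tile, t \in L & c \in cells t) (c \in region L).
Proof. exact: flatten_mapP. Qed.

Lemma mem_cells (t : tile) (c : nat * nat) :
  (c \in cells t) =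
  [&& t.1.1 <= c.1 <= t.1.1.+1, t.1.2 <= c.2 <= t.1.2.+1
    & c != (t.1.1 + t.2.1, t.1.2 + t.2.2)].
Proof.
case: t c => [[i j] [[] []]] [x y];
  by rewrite /cells /= !inE /= !xpair_eqE /=; lia.
Qed.

(** This makes the sets of squares of distinct tiles disjoint. *)
Lemma region_uniq_inj L t u c :
  uniq (region L) -> t \in L -> u \in L -> c \in cells t -> c \in cells u ->
  t = u.
Proof.
move=> uL tL uinL ct cu; apply/eqP/negPn/negP => neq.
have uL' : u \in rem t L.
  by have := perm_mem (perm_to_rem tL) u; rewrite uinL inE eq_sym (negPf neq).
move: uL; rewrite (perm_uniq (perm_region (perm_to_rem tL))) /region /=.
rewrite cat_uniq => /and3P[_ /hasP[]]; exists c => //.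
by apply/mem_region; exists u.
Qed.

Lemma crossed_tiling_perm m n L1 L2 :
  perm_eq L1 L2 -> crossed_tiling m n L1 -> crossed_tiling m n L2.
Proof.
move=> eL [hc hr hk]; split.
- by apply: perm_trans hc; rewrite perm_sym perm_region.
- by move=> x /hr; rewrite (perm_mem (perm_map _ eL)).
- by move=> x /hk; rewrite (perm_mem (perm_map _ eL)).
Qed.

(** * From lists to partitions *)

Definition tile_set m n (t : tile) : {set square m n} :=
  [set c : square m n | (c.1 : nat, c.2 : nat) \in cells t].

Lemma crossed_tiling_faultfree m n L : crossed_tiling m n L ->
  exists P : {set {set square m n}}, tromino_tiling P /\ faultfree P.
Proof.
case=> cov hr hk.
have uL : uniq (region L) by rewrite (perm_uniq cov) rect_uniq.
have inb (t : tile) (c : nat * nat) : t \in L -> c \in cells t -> (c.1 < m) && (c.2 < n).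
  move=> tL ct; rewrite -mem_rect -(perm_mem cov).
  by apply/mem_region; exists t.
have real (t : tile) (c : nat * nat) : t \in L -> c \in cells t ->
    exists2 s : square m n, s \in tile_set m n t & s.1 = c.1 :> nat /\ s.2 = c.2 :> nat.
  move=> tL ct; case/andP: (inb t c tL ct) => h1 h2.
  by exists (Ordinal h1, Ordinal h2) => //; rewrite inE /=; case: c ct {h1 h2}.
(* one of the two diagonals of a block avoids the removed square, and its two
   squares lie in different rows and in different columns *)
have spread t : exists c d : nat * nat, [/\ c \in cells t, d \in cells t,
    c.1 = t.1.1 /\ d.1 = t.1.1.+1 & c.2 = t.1.2 /\ d.2 = t.1.2.+1 \/
                                    c.2 = t.1.2.+1 /\ d.2 = t.1.2].
  case: t => [[i j] [a b]]; case e: (a == b).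
    exists (i, j.+1), (i.+1, j); rewrite !mem_cells /= !xpair_eqE.
    by split; [lia | lia | | right].
  exists (i, j), (i.+1, j.+1); rewrite !mem_cells /= !xpair_eqE.
  by split; [lia | lia | | left].
exists [set:: [seq tile_set m n t | t <- L]].
have memP T : reflect (exists2 t : tile, t \in L & T = tile_set m n t)
    (T \in [set:: [seq tile_set m n t | t <- L]]).
  by rewrite inE; apply: mapP.
split; split.
- apply/and3P; split.
  + apply/eqP/setP => s; rewrite inE; apply/bigcupP.
    have : (s.1 : nat, s.2 : nat) \in region L.
      by rewrite (perm_mem cov) mem_rect /= !ltn_ord.
    case/mem_region=> t tL st; exists (tile_set m n t); last by rewrite inE.
    by apply/memP; exists t.
  + apply/trivIsetP => T U /memP[t tL ->] /memP[u uinL ->] neq.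
    apply/pred0P => s /=; apply/negP => /andP[]; rewrite !inE => st su.
    by case/eqP: neq; rewrite (region_uniq_inj uL tL uinL st su).
  + apply/negP => /memP[t tL e]; have [c [d [ct _ _ _]]] := spread t.
    by have [s] := real t c tL ct; rewrite -e inE.
- move=> T /memP[t tL ->]; have [c [d [ct dt [h1 h2] h3]]] := spread t.
  have /= b1 := inb t c tL ct; have /= b2 := inb t d tL dt.
  have im : t.1.1.+1 < m by lia.
  have jn : t.1.2.+1 < n by lia.
  exists t.1.1, t.1.2; split=> //.
  have hi : t.1.1 + t.2.1 < m by case: t.2.1; lia.
  have hj : t.1.2 + t.2.2 < n by case: t.2.2; lia.
  exists (Ordinal hi, Ordinal hj).
    by rewrite inE /=; case: t.2.1 t.2.2 => -[]; lia.
  apply/setP => -[x y]; rewrite !inE mem_cells /= !xpair_eqE -!val_eqE /=.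
  lia.
- case=> k [kb fault].
  have /mapP[t tL ek] : k.-1 \in rows L by apply: hr; rewrite mem_iota; lia.
  have [c [d [ct dt [h1 h2] h3]]] := spread t.
  have [s ss [es _]] := real t c tL ct; have [r rs [er _]] := real t d tL dt.
  have /fault[] : tile_set m n t \in [set:: [seq tile_set m n t | t <- L]].
    by apply/memP; exists t.
  + by move/(_ r rs); lia.
  + by move/(_ s ss); lia.
- case=> k [kb fault].
  have /mapP[t tL ek] : k.-1 \in cols L by apply: hk; rewrite mem_iota; lia.
  have [c [d [ct dt _ h3]]] := spread t.
  have [s ss [_ es]] := real t c tL ct; have [r rs [_ er]] := real t d tL dt.
  have /fault[] : tile_set m n t \in [set:: [seq tile_set m n t | t <- L]].
    by apply/memP; exists t.
  + by move=> hf; have := hf r rs; have := hf s ss; lia.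
  + by move=> hf; have := hf r rs; have := hf s ss; lia.
Qed.

(** * Transposition and translation *)

Definition swap A B (p : A * B) : B * A := (p.2, p.1).

(** Exchanging rows and columns reduces the theorem to the case [3 %| n]. *)
Lemma crossed_tiling_tr m n L : crossed_tiling m n L ->
  exists L', crossed_tiling n m L'.
Proof.
case=> cov hr hk; exists [seq (swap t.1, swap t.2) | t : tile <- L].
have swapK A B : cancel (@swap A B) (@swap B A) by case.
split; last 2 first.
- by move=> x /hk; rewrite /rows -map_comp.
- by move=> x /hr; rewrite /cols -map_comp.
have e1 : perm_eq (rect n m) (map (@swap _ _) (rect m n)).
  apply: uniq_perm; rewrite ?rect_uniq ?(map_inj_uniq (can_inj (@swapK _ _))) ?rect_uniq //.
  move=> c; rewrite mem_rect; apply/idP/mapP => [hc | [d]].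
    by exists (swap c); rewrite ?swapK // mem_rect andbC.
  by rewrite mem_rect andbC => hd ->.
rewrite perm_sym (perm_trans e1) // perm_sym.
apply: (@perm_trans _ (map (@swap _ _) (region L))); last exact: perm_map.
elim: L {hr hk cov} => // t L IH; rewrite /region /= map_cat.
apply: perm_cat => //; case: t => [[i j] [[] []]]; rewrite /cells /swap /=;
  by apply/permP => p /=; lia.
Qed.

Definition shift h w (c : nat * nat) : nat * nat := (h + c.1, w + c.2).

Definition translate h w (L : seq tile) : seq tile :=
  [seq (shift h w t.1, t.2) | t <- L].

Lemma region_translate h w L : region (translate h w L) = map (shift h w) (region L).
Proof.
rewrite /region /translate map_flatten -!map_comp; congr flatten.
apply: eq_map => t /=; rewrite /cells -map_comp.
by apply: eq_map => p; rewrite /shift /= !addnA.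
Qed.

Lemma translate_cat h w L1 L2 :
  translate h w (L1 ++ L2) = translate h w L1 ++ translate h w L2.
Proof. exact: map_cat. Qed.

Lemma translateD a b c d L :
  translate a b (translate c d L) = translate (a + c) (b + d) L.
Proof.
by rewrite /translate -map_comp; apply: eq_map => t; rewrite /shift /= !addnA.
Qed.

Lemma translate0 L : translate 0 0 L = L.
Proof. by rewrite /translate -[RHS]map_id; apply: eq_map => -[[]]. Qed.

Lemma rows_translate h w L : rows (translate h w L) = [seq h + i | i <- rows L].
Proof. by rewrite /rows -!map_comp. Qed.

Lemma cols_translate h w L : cols (translate h w L) = [seq w + j | j <- cols L].
Proof. by rewrite /cols -!map_comp. Qed.

Lemma shift_inj h w : injective (shift h w).
Proof. by move=> [a b] [c d] [/addnI-> /addnI->]. Qed.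

Lemma mem_shift_rect h w m n (c : nat * nat) :
  (c \in map (shift h w) (rect m n)) = (h <= c.1 < h + m) && (w <= c.2 < w + n).
Proof.
apply/mapP/idP => [[d] | hc]; first by rewrite mem_rect => ? -> /=; lia.
exists (c.1 - h, c.2 - w); first by rewrite mem_rect /=; lia.
by case: c hc => x y /= ?; rewrite /shift /=; congr pair; lia.
Qed.

Lemma rect_addr m n k :
  perm_eq (rect m (n + k)) (rect m n ++ map (shift 0 n) (rect m k)).
Proof.
apply: uniq_perm; first exact: rect_uniq.
  rewrite cat_uniq rect_uniq (map_inj_uniq (@shift_inj _ _)) rect_uniq /= andbT.
  by apply/hasPn => c; rewrite mem_shift_rect /= mem_rect; lia.
by move=> c; rewrite mem_cat mem_shift_rect !mem_rect; lia.
Qed.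

Lemma rect_addl m n k :
  perm_eq (rect (m + k) n) (rect m n ++ map (shift m 0) (rect k n)).
Proof.
apply: uniq_perm; first exact: rect_uniq.
  rewrite cat_uniq rect_uniq (map_inj_uniq (@shift_inj _ _)) rect_uniq /= andbT.
  by apply/hasPn => c; rewrite mem_shift_rect /= mem_rect; lia.
by move=> c; rewrite mem_cat mem_shift_rect !mem_rect; lia.
Qed.

(** * Enlarging a tiling by retiling a patch on its border *)

(** The data of an exchange that can be made in any tiling which contains a
    translate of [A]: the tiled region grows by [D], and no line that was
    crossed by [A] becomes a fault line. *)
Definition enlarges (A A' : seq tile) (D : seq (nat * nat)) : bool :=
  [&& perm_eq (region A') (region A ++ D),
      all (mem (rows A')) (rows A) & all (mem (cols A')) (cols A)].

(** [E] fills the part of the new rows or columns that lies beside the patch. It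
    may be tiled arbitrarily, since the lines through it are crossed either by
    [A'] or by the tiles of [L]. *)
Lemma retile m n m' n' h w A A' D E L :
  enlarges A A' D -> crossed_tiling m n (translate h w A ++ L) ->
  perm_eq (rect m' n') (rect m n ++ map (shift h w) D ++ region E) ->
  {subset iota m.-1 (m' - m) <= rows (translate h w A')} ->
  {subset iota n.-1 (n' - n) <= cols (translate h w A')} ->
  crossed_tiling m' n' (translate h w A' ++ L ++ E).
Proof.
case/and3P=> /permP eA /allP sr /allP sc [/permP cov hr hk] /permP e nr nc.
have {}sr : {subset rows (translate h w A) <= rows (translate h w A')}.
  rewrite !rows_translate => x /mapP[i /sr ii ->]; exact: map_f.
have {}sc : {subset cols (translate h w A) <= cols (translate h w A')}.
  rewrite !cols_translate => x /mapP[i /sc ii ->]; exact: map_f.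
split.
- apply/permP => p; move: (cov p).
  rewrite e !region_cat !region_translate !count_cat !count_map => <-.
  by rewrite eA count_cat addnACA.
- move=> x; have [xm | xm] := ltnP x m.-1 => hx.
    have : x \in iota 0 m.-1 by rewrite mem_iota.
    move/hr; rewrite /rows !map_cat !mem_cat => /orP[/sr -> // | ->].
    by rewrite orbT.
  have : x \in iota m.-1 (m' - m) by move: hx; rewrite !mem_iota; lia.
  by move/nr; rewrite /rows map_cat mem_cat => ->.
- move=> x; have [xm | xm] := ltnP x n.-1 => hx.
    have : x \in iota 0 n.-1 by rewrite mem_iota.
    move/hk; rewrite /cols !map_cat !mem_cat => /orP[/sc -> // | ->].
    by rewrite orbT.
  have : x \in iota n.-1 (n' - n) by move: hx; rewrite !mem_iota; lia.
  by move/nc; rewrite /cols map_cat mem_cat => ->.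
Qed.

(** The patch [B] is positioned in the last columns of a rectangle with six
    columns, and [T] fills the gap of width [k] that opens when [B] is moved to
    the right. The new vertical lines are [6], ..., [5 + k], and line [j.+1] is
    crossed by the blocks that start in column [j]. *)
Definition column_step m k (B T : seq tile) : bool :=
  enlarges B (T ++ translate 0 k B) (map (shift 0 6) (rect m k)) &&
  all (mem (cols (T ++ translate 0 k B))) (iota 5 k).

(** The tiles [L] are kept, which preserves a patch located away from [B]. *)
Lemma add_columns m k B T L w q : column_step m k B T ->
  crossed_tiling m (6 + w) (translate 0 w B ++ L) ->
  exists L', crossed_tiling m (6 + (w + q * k)) (translate 0 (w + q * k) B ++ L ++ L').
Proof.
case/andP=> step /allP new base.
elim: q => [|q [L' IH]]; first by exists [::]; rewrite cats0 addn0.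
set v := w + q * k in IH *; exists (L' ++ translate 0 v T).
have -> : w + q.+1 * k = v + k by rewrite /v; lia.
have := @retile _ _ m (6 + (v + k)) _ _ _ _ _ [::] _ step IH.
rewrite subnn => H; apply: crossed_tiling_perm (H _ _ _) => //.
- by rewrite cats0 translate_cat translateD -catA perm_catC -!catA.
- rewrite cats0 addnA -map_comp.
  have -> : map (shift 0 v \o shift 0 6) (rect m k) = map (shift 0 (6 + v)) (rect m k).
    by apply: eq_map => c; rewrite /shift /= !addnA [v + 6]addnC.
  exact: rect_addr.
- move=> x; rewrite mem_iota cols_translate => hx.
  have -> : x = v + (x - v) by lia.
  by apply/map_f/new; rewrite mem_iota; lia.
Qed.

Definition bricks q : seq tile :=
  flatten [seq [:: se 0 (3 * i); nw 0 (3 * i).+1] | i <- iota 0 q].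

Lemma bricksP q : perm_eq (region (bricks q)) (rect 2 (3 * q)).
Proof.
elim: q => // q IH; rewrite -[q.+1]addn1 /bricks iotaD map_cat flatten_cat -/(bricks q).
rewrite region_cat mulnDr perm_sym (perm_trans (rect_addr _ _ _)) //.
rewrite perm_sym; apply: perm_cat => //; rewrite /region /cells /shift /= !addn0.
by rewrite add0n !addn1 !addn2; apply/permP => p /=; lia.
Qed.

(** The patch [A] is positioned in the last rows of a rectangle with four rows and
    six columns, and [T] fills the gap of height 2 that opens when [A] is moved
    down; the blocks that cross the new lines [4] and [5] start in rows [3] and
    [4]. *)
Definition row_step (A T : seq tile) : bool :=
  enlarges A (T ++ translate 2 0 A) (map (shift 4 0) (rect 2 6)) &&
  all (mem (rows (T ++ translate 2 0 A))) [:: 3; 4].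

(** The number of columns exceeds the width of the patch by a multiple of 3, so
    that bricks complete each pair of new rows. *)
Lemma add_rows q A T L g h : row_step A T ->
  crossed_tiling (4 + g) (6 + 3 * q) (translate g 0 A ++ L) ->
  exists L', crossed_tiling (4 + (g + h * 2)) (6 + 3 * q) L'.
Proof.
case/andP=> step /allP new base.
suff [L' ?] : exists L', crossed_tiling (4 + (g + h * 2)) (6 + 3 * q)
    (translate (g + h * 2) 0 A ++ L') by eexists; eauto.
elim: h => [|h [L' IH]]; first by exists L; rewrite addn0.
set v := g + h * 2 in IH *.
exists (translate v 0 T ++ L' ++ translate (4 + v) 6 (bricks q)).
have -> : g + h.+1 * 2 = v + 2 by rewrite /v; lia.
have := @retile _ _ (4 + (v + 2)) (6 + 3 * q) _ _ _ _ _
  (translate (4 + v) 6 (bricks q)) _ step IH.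
rewrite subnn => H; apply: crossed_tiling_perm (H _ _ _) => //.
- by rewrite translate_cat translateD -catA perm_catCA.
- apply/permP => p.
  rewrite addnA (permP (rect_addl (4 + v) (6 + 3 * q) 2)) !count_cat.
  congr (_ + _); rewrite count_map (permP (rect_addr _ _ _)) count_cat.
  rewrite region_translate !count_map (permP (bricksP q)).
  by congr (_ + _); apply: eq_count => c /=; rewrite /shift /= ?addnA ?add0n ?addn0 [v + 4]addnC.
- move=> x; rewrite mem_iota rows_translate => hx.
  have -> : x = v + (x - v) by lia.
  by apply/map_f/new; rewrite !inE; lia.
Qed.

(** * Explicit patches and tilings *)

(** The initial tilings were found by enumerating the faultfree tilings of the
    three rectangles, and the fillings by exhausting the tilings of the gaps that
    open along their cuts. *)

Definition even_bottom := [:: se 1 1; ne 2 0; ne 2 2].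
Definition even_right := [:: sw 0 4; nw 1 3; nw 2 4].

Lemma even_row_step : row_step even_bottom [:: sw 1 1; se 2 0; ne 3 3; nw 4 4].
Proof. by []. Qed.

Lemma even_column_step :
  column_step 4 3 even_right [:: ne 0 4; sw 0 5; sw 2 3; ne 2 5].
Proof. by []. Qed.

Definition odd_bottom := [:: nw 2 2; ne 2 4].
Definition odd_right := [:: sw 0 4; se 1 3; sw 2 4].

Lemma odd_row_step : row_step odd_bottom [:: se 2 3; nw 3 1; sw 3 4; ne 4 0].
Proof. by []. Qed.

Lemma odd_column_step :
  column_step 5 6 odd_right
    [:: se 0 4; sw 0 6; se 0 8; ne 1 3; sw 1 5; ne 2 5; sw 2 7; nw 3 6; nw 3 8;
        ne 3 10].
Proof. by []. Qed.

Lemma crossed_tiling_check m n L :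
  [&& perm_eq (region L) (rect m n), all (mem (rows L)) (iota 0 m.-1)
    & all (mem (cols L)) (iota 0 n.-1)] -> crossed_tiling m n L.
Proof. by case/and3P=> ? /allP ? /allP ?. Qed.

Lemma tiling_4_6 :
  crossed_tiling 4 6 (even_right ++ even_bottom ++ [:: se 0 0; sw 0 2]).
Proof. exact: crossed_tiling_check. Qed.

Lemma tiling_5_6 :
  crossed_tiling 5 6 (odd_right ++ translate 1 0 odd_bottom ++
    [:: sw 0 0; se 0 2; ne 1 0; nw 2 1; ne 3 0]).
Proof. exact: crossed_tiling_check. Qed.

Lemma tiling_5_9 :
  crossed_tiling 5 9 (translate 0 3 odd_right ++ translate 1 0 odd_bottom ++
    [:: ne 0 0; sw 0 1; se 0 3; se 0 5; ne 1 4; sw 2 0; se 2 2; ne 3 0;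
        sw 3 5; ne 3 7]).
Proof. exact: crossed_tiling_check. Qed.

Lemma crossed_tiling_dvd3_cols m n : 4 <= m -> 4 <= n -> 3 %| n ->
  exists L, crossed_tiling m n L.
Proof.
move=> hm hn /dvdnP[r er].
have [q {r er hn}->] : exists q, n = 6 + 3 * q by exists (r - 2); lia.
have [h [->|->]] : exists h, m = 4 + (0 + h * 2) \/ m = 4 + (1 + h * 2).
  by exists ((m - 4) %/ 2); lia.
(* by the parity of m, the rows grow from four or from five *)
- have [L'] := @add_columns _ _ _ _ _ 0 q even_column_step tiling_4_6.
  rewrite add0n [q * 3]mulnC => H.
  apply: (@add_rows q _ _ _ 0 h even_row_step).
  apply: crossed_tiling_perm H; rewrite translate0 -!catA perm_catCA; exact: perm_refl.
- have [L H] : exists L, crossed_tiling 5 (6 + 3 * q) (translate 1 0 odd_bottom ++ L).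
    (* six columns at a time: the parity of q selects the initial tiling *)
    have [s [->|->]] : exists s, q = 0 + 2 * s \/ q = 1 + 2 * s.
      by exists (q %/ 2); lia.
    + have [L'] := @add_columns _ _ _ _ _ 0 s odd_column_step tiling_5_6.
      have -> : 0 + s * 6 = 3 * (0 + 2 * s) by lia.
      move=> H; eexists; apply: crossed_tiling_perm H.
      by rewrite -!catA perm_catCA; exact: perm_refl.
    + have [L'] := @add_columns _ _ _ _ _ 3 s odd_column_step tiling_5_9.
      have -> : 3 + s * 6 = 3 * (1 + 2 * s) by lia.
      move=> H; eexists; apply: crossed_tiling_perm H.
      by rewrite -!catA perm_catCA; exact: perm_refl.
  exact: (@add_rows q _ _ _ 1 h odd_row_step H).
Qed.

Theorem theorem2 (m n : nat) (hm : 4 <= m) (hn : 4 <= n) (hmn : 3 %| m * n) :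
  exists P : {set {set square m n}}, tromino_tiling P /\ faultfree P.
Proof.
suff [L hL] : exists L, crossed_tiling m n L by apply: crossed_tiling_faultfree hL.
move: hmn; rewrite Euclid_dvdM // => /orP[hm3 | hn3]; last first.
  exact: crossed_tiling_dvd3_cols.
have [L hL] := crossed_tiling_dvd3_cols hn hm hm3.
exact: crossed_tiling_tr hL.
Qed.
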